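(* Let $d>1$, $n\ge 1$. Consider the (analyst's) model in which ${\bf y}_1,\dots,{\bf y}_n$ are i.i.d. $\mathcal{N}(\boldsymbol{\theta},\Lambda)$ with $\Lambda$ a known $d\times d$ positive definite covariance matrix and $\boldsymbol{\theta}\in\mathbb{R}^d$ unknown with prior $\mathcal{N}(\boldsymbol{\mu}^{\pi},\Sigma^{\pi})$, $\Sigma^{\pi}$ positive definite. Let $\Sigma^{p}=\left[(\Sigma^{\pi})^{-1}+n\Lambda^{-1}\right]^{-1}$. Suppose the data are actually generated as ${\bf y}_i\stackrel{\rm i.i.d.}{\sim}\mathcal{N}(\boldsymbol{\mu}^{o},\Sigma^{o})$, $i=1,\dots,n$, where $\boldsymbol{\mu}^{o}\in\mathbb{R}^d$ and $\Sigma^{o}$ is positive definite (not necessarily equal to $\Lambda$). Then for any $\boldsymbol{\lambda}\in\mathbb{R}^d$, the probability (under the data generating model) that the discrepant posterior phenomenon (DPP) occurs for $\eta=\boldsymbol{\lambda}^{\top}\boldsymbol{\theta}$ is positive, except exactly when there is a positive constant $c$ such that $$\boldsymbol{\lambda}^{\top}\Sigma^{p}\left(\Lambda^{-1}-c\,(\Sigma^{\pi})^{-1}\right)=0 .$$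
   Context: In the analyst's model the likelihood is $L(\boldsymbol{\theta}\mid{\bf y})\propto\phi(\boldsymbol{\theta};\boldsymbol{\mu}^{L},\Sigma^{L})$ with $\boldsymbol{\mu}^{L}=\overline{\bf y}_n=\frac1n\sum_{i=1}^n{\bf y}_i$ and $\Sigma^{L}=\Lambda/n$, where $\phi(\cdot;\boldsymbol{\mu},\Sigma)$ is the Gaussian density with mean $\boldsymbol{\mu}$ and covariance $\Sigma$. The posterior is computed from the prior and this likelihood; $\boldsymbol{\mu}^{p}$ denotes the posterior mean of $\boldsymbol{\theta}$. Write $\eta^{p}=\boldsymbol{\lambda}^{\top}\boldsymbol{\mu}^{p}$, $\eta^{\pi}=\boldsymbol{\lambda}^{\top}\boldsymbol{\mu}^{\pi}$, $\eta^{L}=\boldsymbol{\lambda}^{\top}\boldsymbol{\mu}^{L}$. Definition: the discrepant posterior phenomenon (DPP) occurs if $(\eta^{p}-\eta^{\pi})(\eta^{p}-\eta^{L})>0$. *)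

(* Defs.v *)
From HB Require Import structures.
From mathcomp Require Import all_boot all_order all_algebra.
From mathcomp Require Import all_classical all_reals all_analysis.

Set Implicit Arguments.
Unset Strict Implicit.
Unset Printing Implicit Defensive.

Import Order.TTheory GRing.Theory Num.Theory.
Import numFieldNormedType.Exports.

Local Open Scope classical_set_scope.
Local Open Scope ring_scope.

Definition cV_display : measure_display. Proof. exact. Qed.

Section measurable_cV.
Context {R : realType} (n : nat).

Let coord (i : 'I_n) (x : 'cV[R]_n) : measurableTypeR R := x i ord0.

Let cV_set0 : g_sigma_preimage coord set0.
Proof. exact: sigma_algebra0. Qed.

Let cV_setC A : g_sigma_preimage coord A -> g_sigma_preimage coord (~` A).
Proof. exact: sigma_algebraC. Qed.

Let cV_bigcup (F : (set 'cV[R]_n)^nat) :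
  (forall i, g_sigma_preimage coord (F i)) ->
  g_sigma_preimage coord (\bigcup_i (F i)).
Proof. exact: sigma_algebra_bigcup. Qed.

(* The sigma-algebra generated by the coordinates, as for [n.-tuple R]. *)
HB.instance Definition _ := @isMeasurable.Build cV_display
  'cV[R]_n (g_sigma_preimage coord) cV_set0 cV_setC cV_bigcup.

End measurable_cV.

Lemma measurable_coord (R : realType) n (i : 'I_n) :
  measurable_fun [set: 'cV[R]_n] (fun x => x i ord0).
Proof.
move=> _ Y mY; rewrite setTI; apply: sub_sigma_algebra => /=.
rewrite -bigcup_seq/=; exists i => /=; first by rewrite mem_index_enum.
by exists Y => //; rewrite setTI.
Qed.

Lemma measurable_fun_cVP d (T : measurableType d) (R : realType) n
    (f : T -> 'cV[R]_n) :
  measurable_fun [set: T] f <->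
  forall i, measurable_fun [set: T] (fun t => f t i ord0).
Proof.
split=> [mf i|mf].
  exact: (measurableT_comp (@measurable_coord R n i) mf).
pose S := [set A : set 'cV[R]_n | measurable (f @^-1` A)].
suff h : (@measurable _ 'cV[R]_n) `<=` S.
  by move=> _ A mA; rewrite setTI; exact: h.
apply: smallest_sub; first split.
- by rewrite /S /= preimage_set0.
- by move=> A SA; rewrite /S /= setTD preimage_setC; exact: measurableC.
- by move=> F SF; rewrite /S /= preimage_bigcup; exact: bigcupT_measurable.
- move=> A; rewrite -bigcup_seq/= => -[i _] [B mB] <-.
  by rewrite /S /= setTI; have := mf i measurableT B mB; rewrite setTI.
Qed.

Section cons_cV.
Context {R : realType} (n : nat).

Definition cons_cV (p : measurableTypeR R * 'cV[R]_n) : 'cV[R]_n.+1 :=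
  col_mx (const_mx p.1 : 'cV[R]_1) p.2.

Lemma cons_cV0 p : cons_cV p ord0 ord0 = p.1.
Proof.
rewrite /cons_cV (_ : @ord0 n = lshift n (@ord0 0)); last exact: val_inj.
by rewrite [LHS]col_mxEu mxE.
Qed.

Lemma cons_cV_lift p i : cons_cV p (lift ord0 i) ord0 = p.2 i ord0.
Proof.
rewrite /cons_cV (_ : lift (@ord0 n) i = rshift 1 i); last exact: val_inj.
by rewrite [LHS]col_mxEd.
Qed.

Lemma measurable_cons_cV : measurable_fun setT cons_cV.
Proof.
apply/measurable_fun_cVP => i; have [j ->|->] := unliftP ord0 i.
  under eq_fun do rewrite cons_cV_lift.
  exact: (measurableT_comp (@measurable_coord R n j) measurable_snd).
by under eq_fun do rewrite cons_cV0; exact: measurable_fst.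
Qed.

Definition uncons_cV (x : 'cV[R]_n.+1) : measurableTypeR R * 'cV[R]_n :=
  (x ord0 ord0, \col_i x (lift ord0 i) ord0).

Lemma uncons_cVK : cancel uncons_cV cons_cV.
Proof.
move=> x; apply/matrixP => i j; rewrite (ord1 j).
have [k ->|->] := unliftP ord0 i; last by rewrite cons_cV0.
by rewrite cons_cV_lift mxE.
Qed.

Lemma cons_cVK : cancel cons_cV uncons_cV.
Proof.
move=> [a x]; rewrite /uncons_cV cons_cV0; congr pair.
by apply/matrixP => i j; rewrite (ord1 j) mxE cons_cV_lift.
Qed.

Lemma measurable_uncons_cV : measurable_fun setT uncons_cV.
Proof.
apply/measurable_fun_pair; first exact: measurable_coord.
apply/measurable_fun_cVP => i.
by under eq_fun do rewrite mxE; exact: measurable_coord.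
Qed.

Variable mu : {sigma_finite_measure set 'cV[R]_n -> \bar R}.

Definition lebesgue_cV_step : set 'cV[R]_n.+1 -> \bar R :=
  pushforward (@lebesgue_measure R \x mu)%E cons_cV.

Let cons_cV_preimage A : measurable A -> measurable (cons_cV @^-1` A).
Proof. by move=> mA; rewrite -[X in measurable X]setTI; exact: measurable_cons_cV. Qed.

Let lebesgue_cV_step0 : lebesgue_cV_step set0 = 0%E.
Proof. by rewrite /lebesgue_cV_step /pushforward preimage_set0 measure0. Qed.

Let lebesgue_cV_step_ge0 A : (0 <= lebesgue_cV_step A)%E.
Proof. by rewrite /lebesgue_cV_step /pushforward; exact: measure_ge0. Qed.

Let lebesgue_cV_step_sigma_additive : semi_sigma_additive lebesgue_cV_step.
Proof.
move=> F mF tF mUF; rewrite /lebesgue_cV_step /pushforward preimage_bigcup.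
apply: measure_semi_sigma_additive.
- by move=> k; exact: cons_cV_preimage.
- apply/trivIsetP => /= i j _ _ ij; rewrite -preimage_setI.
  by move/trivIsetP : tF => /(_ _ _ _ _ ij) ->//; rewrite preimage_set0.
- by rewrite -preimage_bigcup; exact: cons_cV_preimage.
Qed.

HB.instance Definition _ := isMeasure.Build _ _ _ lebesgue_cV_step
  lebesgue_cV_step0 lebesgue_cV_step_ge0 lebesgue_cV_step_sigma_additive.

Let lebesgue_cV_step_sigma_finite : sigma_finite setT lebesgue_cV_step.
Proof.
have /sigma_finiteP[F [TF ndF Foo]] := sigma_finiteT (@lebesgue_measure R).
have /sigma_finiteP[G [TG ndG Goo]] := sigma_finiteT mu.
exists (fun k => uncons_cV @^-1` (F k `*` G k)).
  apply/seteqP; split=> // x _.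
  have [k _ Fkx] : (\bigcup_k F k) (uncons_cV x).1 by rewrite -TF.
  have [l _ Glx] : (\bigcup_k G k) (uncons_cV x).2 by rewrite -TG.
  exists (maxn k l) => //; split.
  - by move: Fkx; apply/subsetPset/ndF/leq_maxl.
  - by move: Glx; apply/subsetPset/ndG/leq_maxr.
move=> k; have [mF Fk] := Foo k; have [mG Gk] := Goo k; split.
  by rewrite -[X in measurable X]setTI; apply: measurable_uncons_cV => //;
    exact: measurableX.
rewrite /lebesgue_cV_step /pushforward.
rewrite (_ : cons_cV @^-1` _ = F k `*` G k); last first.
  by apply/funext => p; rewrite /preimage /mkset cons_cVK.
by rewrite product_measure1E// lte_mul_pinfty// ge0_fin_numE.
Qed.

HB.instance Definition _ := Measure_isSigmaFinite.Build _ _ _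
  lebesgue_cV_step lebesgue_cV_step_sigma_finite.

End cons_cV.

(* The n-fold product of the Lebesgue measure on R, as [lebesgue_cV_box] shows. *)
Fixpoint lebesgue_cV (R : realType) (n : nat) :
    {sigma_finite_measure set 'cV[R]_n -> \bar R} :=
  match n with
  | 0%N => (\d_(0 : 'cV[R]_0))%R
  | m.+1 => lebesgue_cV_step (lebesgue_cV R m)
  end.

Lemma lebesgue_cV_box (R : realType) n (A : 'I_n -> set (measurableTypeR R)) :
  (forall i, measurable (A i)) ->
  lebesgue_cV R n [set x | forall i, A i (x i ord0)] =
  (\prod_(i < n) lebesgue_measure (A i))%E.
Proof.
elim: n A => [A _|n ih A mA] /=.
  by rewrite big_ord0 diracE mem_set//= => -[].
pose B := [set x : 'cV[R]_n | forall i, A (lift ord0 i) (x i ord0)].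
have mB : measurable B.
  rewrite (_ : B = \bigcap_(i in [set: 'I_n])
      ((fun x : 'cV[R]_n => x i ord0) @^-1` A (lift ord0 i))).
    apply: fin_bigcap_measurable => [|i _]; first exact: finite_finset.
    by have := @measurable_coord R n i measurableT _ (mA (lift ord0 i)); rewrite setTI.
  by apply/seteqP; split=> [x h i _|x h i]; [exact: h|exact: (h i Logic.I)].
rewrite big_ord_recl -[X in (_ * X)%E]ih// -/B -product_measure1E//.
rewrite /lebesgue_cV_step /pushforward; congr product_measure1.
apply/seteqP; split => [p h|p [h0 h] i] /=.
  split; first by have := h ord0; rewrite cons_cV0.
  by move=> i; have := h (lift ord0 i); rewrite cons_cV_lift.
by have [j ->|->] := unliftP ord0 i; rewrite ?cons_cV0 ?cons_cV_lift//; exact: h.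
Qed.

(* A covariance matrix is symmetric, so symmetry is part of the definition. *)
Definition posdefmx (R : realType) d (S : 'M[R]_d) : Prop :=
  S^T = S /\
  forall v : 'cV[R]_d, v != 0 -> 0 < (v^T *m S *m v) ord0 ord0.

Definition gauss_pdf (R : realType) d (mu : 'cV[R]_d) (S : 'M[R]_d)
    (x : 'cV[R]_d) : R :=
  (Num.sqrt ((2 * pi) ^+ d * \det S))^-1 *
  expR (- (((x - mu)^T *m invmx S *m (x - mu)) ord0 ord0 / 2)).

Definition gaussian_vector disp (Omega : measurableType disp) (R : realType)
    (P : probability Omega R) d (mu : 'cV[R]_d) (S : 'M[R]_d)
    (X : {RV P >-> 'cV[R]_d}) : Prop :=
  forall A : set 'cV[R]_d, measurable A ->
    distribution P X A = (\int[lebesgue_cV R d]_(x in A) (gauss_pdf mu S x)%:E)%E.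

(* Taking some of the [A i] equal to [setT] gives the product rule for every
   subfamily. *)
Definition mutually_independent disp (Omega : measurableType disp)
    (R : realType) (P : probability Omega R) d n
    (X : 'I_n -> {RV P >-> 'cV[R]_d}) : Prop :=
  forall A : 'I_n -> set 'cV[R]_d, (forall i, measurable (A i)) ->
    P (\bigcap_(i in [set: 'I_n]) (X i @^-1` A i)) =
    (\prod_(i < n) P (X i @^-1` A i))%E.

Section bayes.
Context {R : realType} {d n : nat}.

(* As a function of [theta] this is proportional to
   [gauss_pdf (sample_mean y) (n%:R^-1 *: Lambda)]. *)
Definition likelihood (Lambda : 'M[R]_d) (y : 'I_n -> 'cV[R]_d)
    (theta : 'cV[R]_d) : R :=
  \prod_(i < n) gauss_pdf theta Lambda (y i).

Definition posterior_pdf (prior lik : 'cV[R]_d -> R) (theta : 'cV[R]_d) : R :=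
  prior theta * lik theta /
  (\int[lebesgue_cV R d]_t (prior t * lik t)).

Definition pdf_mean (f : 'cV[R]_d -> R) : 'cV[R]_d :=
  \col_i (\int[lebesgue_cV R d]_t (t i ord0 * f t)).

Definition posterior_mean (mupi : 'cV[R]_d) (Sigmapi Lambda : 'M[R]_d)
    (y : 'I_n -> 'cV[R]_d) : 'cV[R]_d :=
  pdf_mean (posterior_pdf (gauss_pdf mupi Sigmapi) (likelihood Lambda y)).

Definition sample_mean (y : 'I_n -> 'cV[R]_d) : 'cV[R]_d :=
  n%:R^-1 *: \sum_(i < n) y i.

Definition linear_feature (lambda mu : 'cV[R]_d) : R :=
  (lambda^T *m mu) ord0 ord0.

Definition DPP (mupi : 'cV[R]_d) (Sigmapi Lambda : 'M[R]_d)
    (lambda : 'cV[R]_d) (y : 'I_n -> 'cV[R]_d) : Prop :=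
  let etap := linear_feature lambda (posterior_mean mupi Sigmapi Lambda y) in
  let etapi := linear_feature lambda mupi in
  let etaL := linear_feature lambda (sample_mean y) in
  0 < (etap - etapi) * (etap - etaL).

End bayes.

Definition posterior_cov (R : realType) d (n : nat) (Sigmapi Lambda : 'M[R]_d) :
    'M[R]_d :=
  invmx (invmx Sigmapi + n%:R *: invmx Lambda).

(* Main.v *)
(* The posterior mean is [Sigmap (Sigmapi^-1 mupi + n Lambda^-1 ybar)]: completing
   the square, the posterior density is proportional to a Gaussian kernel centred
   there, and Lebesgue measure is invariant under the reflection in its centre.
   Hence, with [z = ybar - mupi], [a = lambda^T Sigmap Lambda^-1] and
   [b = lambda^T Sigmap Sigmapi^-1], the DPP says [(a z) (b z) < 0].  If [a = c b]
   with [c > 0] this never happens.  Otherwise the wedge [a z > 0 > b z] is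
   nonempty, open and convex, so it has positive measure, and by independence all
   the observations lie in its translate by [mupi] with positive probability; then
   so does their mean. *)
Require Import Defs.
From HB Require Import structures.
From mathcomp Require Import all_boot all_order all_algebra.
From mathcomp Require Import ring lra.
From mathcomp Require Import all_classical all_reals all_analysis.
From mathcomp Require Import measurable_realfun.
Import Order.TTheory GRing.Theory Num.Theory.
Import numFieldNormedType.Exports.
Local Open Scope classical_set_scope.
Local Open Scope ring_scope.

Set Implicit Arguments.
Unset Strict Implicit.
Unset Printing Implicit Defensive.

(** * Bilinear forms and positive definite matrices *)

Definition bform (R : realType) d (S : 'M[R]_d) (u v : 'cV[R]_d) : R :=
  (u^T *m S *m v) ord0 ord0.

Section bform.
Context {R : realType} {d : nat}.
Implicit Types (S : 'M[R]_d) (u v w : 'cV[R]_d).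

Lemma bformDl S u v w : bform S (u + v) w = bform S u w + bform S v w.
Proof. by rewrite /bform linearD/= !mulmxDl mxE. Qed.

Lemma bformDr S u v w : bform S w (u + v) = bform S w u + bform S w v.
Proof. by rewrite /bform mulmxDr mxE. Qed.

Lemma bformZl S a u v : bform S (a *: u) v = a * bform S u v.
Proof. by rewrite /bform linearZ/= -!scalemxAl mxE. Qed.

Lemma bformZr S a u v : bform S u (a *: v) = a * bform S u v.
Proof. by rewrite /bform -scalemxAr mxE. Qed.

Lemma bformNl S u v : bform S (- u) v = - bform S u v.
Proof. by rewrite -scaleN1r bformZl mulN1r. Qed.

Lemma bformNr S u v : bform S u (- v) = - bform S u v.
Proof. by rewrite -scaleN1r bformZr mulN1r. Qed.

Lemma bformC S u v : S^T = S -> bform S u v = bform S v u.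
Proof.
move=> ST; rewrite /bform -[in LHS](trmxK (_ *m v)) mxE.
by rewrite !trmx_mul trmxK ST mulmxA.
Qed.

Lemma bform_addmx S T u v : bform (S + T) u v = bform S u v + bform T u v.
Proof. by rewrite /bform mulmxDr mulmxDl mxE. Qed.

Lemma bform_scalemx a S u v : bform (a *: S) u v = a * bform S u v.
Proof. by rewrite /bform -scalemxAr -scalemxAl mxE. Qed.

Lemma bformE S u v : bform S u v = \sum_i u i ord0 * (S *m v) i ord0.
Proof. by rewrite /bform -mulmxA mxE; apply: eq_bigr => i _; rewrite mxE. Qed.

Lemma posdefmx_bform_ge0 S v : posdefmx S -> 0 <= bform S v v.
Proof.
move=> [_ Sp]; have [->|/Sp/ltW//] := eqVneq v 0.
by rewrite /bform mulmx0 mxE.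
Qed.

Lemma posdefmx_diag_ge0 S i : posdefmx S -> 0 <= S i i.
Proof.
move=> /(posdefmx_bform_ge0 (delta_mx i ord0)).
by rewrite /bform trmx_delta -rowE -colE !mxE.
Qed.

(** With p, q, r the values of the form at (u,u), (u,v), (v,v), its value at the vector p v - q u is
    p (p r - q^2). This is nonnegative, and p > 0 unless u = 0. *)
Lemma posdefmx_CauchySchwarz S u v : posdefmx S ->
  bform S u v ^+ 2 <= bform S u u * bform S v v.
Proof.
move=> Sp; have [ST Spos] := Sp.
have [->|/Spos] := eqVneq u 0; first by rewrite /bform !trmx0 !mul0mx !mxE expr0n mul0r.
rewrite -/(bform S u u) => u0.
have := posdefmx_bform_ge0 (bform S u u *: v - bform S u v *: u) Sp.
rewrite bformDl !bformDr !(bformNl, bformNr, bformZl, bformZr) (bformC v u ST).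
set p := bform S u u in u0 *; set q := bform S u v; set r := bform S v v => h.
rewrite -subr_ge0 -(pmulr_rge0 _ u0); apply: le_trans h _.
by rewrite le_eqVlt; apply/orP; left; apply/eqP; ring.
Qed.

Lemma posdefmx1 : posdefmx (1%:M : 'M[R]_d).
Proof.
split=> [|v v0]; first exact: trmx1.
rewrite -/(bform _ _ _) bformE; under eq_bigr do rewrite mul1mx -expr2.
rewrite lt_def sumr_ge0 ?andbT => [|i _]; last exact: sqr_ge0.
apply: contra v0; rewrite psumr_eq0 => [/allP h|i _]; last exact: sqr_ge0.
apply/eqP/matrixP => i j; rewrite (ord1 j) mxE.
by have := h i (mem_index_enum i); rewrite sqrf_eq0 => /eqP.
Qed.

Lemma posdefmxD S T : posdefmx S -> posdefmx T -> posdefmx (S + T).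
Proof.
move=> [ST Sp] [TT Tp]; split=> [|v v0]; first by rewrite linearD/= ST TT.
by rewrite -/(bform _ _ _) bform_addmx addr_gt0 ?Sp ?Tp.
Qed.

Lemma posdefmxZ a S : 0 < a -> posdefmx S -> posdefmx (a *: S).
Proof.
move=> a0 [ST Sp]; split=> [|v v0]; first by rewrite linearZ/= ST.
by rewrite -/(bform _ _ _) bform_scalemx mulr_gt0 ?Sp.
Qed.

Lemma posdefmx_unit S : posdefmx S -> S \in unitmx.
Proof.
move=> [ST Sp]; rewrite -row_free_unit -kermx_eq0.
apply/negPn/negP => /rowV0Pn[v /sub_kermxP vS v0].
have /Sp : v^T != 0 by rewrite trmx_eq0.
by rewrite trmxK vS mul0mx mxE ltxx.
Qed.

Lemma posdefmx_inv S : posdefmx S -> posdefmx (invmx S).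
Proof.
move=> Sp; have Su := posdefmx_unit Sp; have [ST Spos] := Sp.
have SVT : (invmx S)^T = invmx S by rewrite trmx_inv ST.
split=> // v v0; have : invmx S *m v != 0.
  by apply: contra v0 => /eqP h; rewrite -[v](mulKVmx Su) h mulmx0.
by move=> /Spos; rewrite trmx_mul SVT -mulmxA mulKVmx.
Qed.

(* The determinant of [(1 - t) I + t S], as a polynomial in t, is 1 at 0 and
   has no root in [0, 1], so it stays positive up to [t = 1]. *)
Lemma posdefmx_det_gt0 S : posdefmx S -> 0 < \det S.
Proof.
move=> Sp.
pose M : 'M[{poly R}]_d := map_mx polyC 1%:M + 'X *: map_mx polyC (S - 1%:M).
have ME t : (\det M).[t] = \det (1%:M + t *: (S - 1%:M)).
  rewrite -[LHS]/(horner_eval t _) -det_map_mx; congr (\det _).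
  apply/matrixP => i j; rewrite !mxE /= /horner_eval.
  by rewrite !hornerE.
rewrite ltNge; apply/negP => S0.
have [t /andP[t0 t1] tdet] : exists2 t, 0 <= t <= 1 & root (- \det M) t.
  apply: poly_ivt; first exact: ler01.
  rewrite !hornerN !ME scale0r addr0 det1 oppr_le0 ler01 oppr_ge0.
  by rewrite scale1r addrCA subrr addr0.
move: tdet; rewrite rootE hornerN oppr_eq0 ME => /eqP tdet.
suff : posdefmx (1%:M + t *: (S - 1%:M)).
  by move=> /posdefmx_unit; rewrite unitmxE tdet unitr0.
have -> : 1%:M + t *: (S - 1%:M) = (1 - t) *: 1%:M + t *: S.
  by apply/matrixP => i j; rewrite !mxE; ring.
have [->|t_neq0] := eqVneq t 0.
  by rewrite scale0r addr0 subr0 scale1r; exact: posdefmx1.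
have tS : posdefmx (t *: S) by apply: posdefmxZ => //; rewrite lt_def t_neq0.
have [->|t_neq1] := eqVneq t 1; first by rewrite subrr scale0r add0r scale1r.
apply: posdefmxD => //; apply: posdefmxZ; last exact: posdefmx1.
by rewrite subr_gt0 lt_def eq_sym t_neq1.
Qed.

(** Cauchy-Schwarz for v and the i-th column of the inverse: the form pairs that column with any w
    to give the i-th coordinate of w, and with itself to give [invmx S i i]. *)
Lemma posdefmx_coord S v i : posdefmx S ->
  v i ord0 ^+ 2 <= invmx S i i * bform S v v.
Proof.
move=> Sp; have Su := posdefmx_unit Sp; have [SVT _] := posdefmx_inv Sp.
pose u := col i (invmx S).
have uS w : bform S u w = w i ord0.
  rewrite /bform /u tr_col SVT -row_mul mulVmx // row1 -rowE.
  by rewrite mxE.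
by have := posdefmx_CauchySchwarz u v Sp; rewrite !uS /u mxE.
Qed.

(** Summing the coordinate bounds controls the squared Euclidean norm by the trace of the inverse
    times the form. No eigenvalues or compactness are involved. *)
Lemma posdefmx_coercive S : posdefmx S ->
  exists2 a, 0 < a & forall v, a * \sum_i v i ord0 ^+ 2 <= bform S v v.
Proof.
move=> Sp; have tr0 : 0 <= \tr (invmx S).
  by rewrite sumr_ge0// => i _; exact/posdefmx_diag_ge0/posdefmx_inv.
(* The added 1 makes the constant positive even for a zero trace, as in dimension 0. *)
exists (1 + \tr (invmx S))^-1.
  by rewrite invr_gt0 ltr_pwDl.
move=> v; rewrite mulrC ler_pdivrMr ?ltr_pwDl// mulrDr mulr1.
rewrite ler_wpDl ?posdefmx_bform_ge0// mulrC /mxtrace mulr_suml.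
by apply: ler_sum => i _; exact: posdefmx_coord.
Qed.

End bform.

(** * Lebesgue measure on column vectors: reflections, product integrands, positivity *)

Lemma lebesgue_measure_reflect (R : realType) (c : R)
    (A : set (measurableTypeR R)) : measurable A ->
  lebesgue_measure ((fun x : measurableTypeR R => c - x : measurableTypeR R)
    @^-1` A) = lebesgue_measure A.
Proof.
have mf : measurable_fun [set: measurableTypeR R]
    (fun x : measurableTypeR R => c - x : measurableTypeR R).
  exact: measurable_funB.
move=> mA; rewrite -/(pushforward _ _ _).
(* Uniqueness leaves only the intervals ]a, b], whose preimage [c - b, c - a[ is closed at the other
   end but has the same length. *)
apply/esym/lebesgue_measure_unique => //= _ [[a b]] _ <-.
rewrite /pushforward (_ : _ @^-1` _ = `[c - b, c - a[%classic).
  rewrite !lebesgue_measure_itv/= !lte_fin ltrD2l ltrN2; case: ifP => // _.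
  by rewrite -!EFinD; congr EFin; ring.
by apply/seteqP; split=> x /=; rewrite !in_itv/= => /andP[? ?];
  apply/andP; split; lra.
Qed.

Section lebesgue_cV.
Context {R : realType}.

Lemma measurable_reflect_cV n (c : 'cV[R]_n) :
  measurable_fun [set: 'cV[R]_n] (fun x => c - x).
Proof.
apply/measurable_fun_cVP => i; under eq_fun do rewrite !mxE.
by apply: measurable_funB => //; exact: measurable_coord.
Qed.

(** Induction on the dimension: a reflection acts on the first coordinate and on the remaining ones
    separately, so uniqueness of product measures reduces the claim to rectangles. *)
Lemma lebesgue_cV_reflect n (c : 'cV[R]_n) (A : set 'cV[R]_n) : measurable A ->
  lebesgue_cV R n ((fun x => c - x) @^-1` A) = lebesgue_cV R n A.
Proof.
elim: n c A => [|n ih] c A mA /=.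
  rewrite (_ : (fun x => c - x) = id)//.
  by apply/funext => x; apply/matrixP => -[].
pose f1 (x : measurableTypeR R) : measurableTypeR R := c ord0 ord0 - x.
pose f2 (x : 'cV[R]_n) := (uncons_cV c).2 - x.
have mf1 : measurable_fun setT f1 by exact: measurable_funB.
have mf2 : measurable_fun setT f2 by exact: measurable_reflect_cV.
pose f (p : measurableTypeR R * 'cV[R]_n) := (f1 p.1, f2 p.2).
have mf : measurable_fun setT f.
  by apply/measurable_fun_pair; [exact: measurableT_comp|exact: measurableT_comp].
rewrite /lebesgue_cV_step /pushforward.
(* Read through [cons_cV], the reflection in dimension n+1 becomes the product map [f]. *)
have -> : cons_cV (n:=n) @^-1` ((fun x => c - x) @^-1` A) =
    f @^-1` (cons_cV (n:=n) @^-1` A).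
  apply/funext => p /=; congr (A _); apply/matrixP => i j; rewrite (ord1 j).
  have -> k : (c - cons_cV p) k ord0 = c k ord0 - cons_cV p k ord0.
    by rewrite mxE [X in _ + X]mxE.
  have [k ->|->] := unliftP ord0 i; last by rewrite !cons_cV0.
  by rewrite !cons_cV_lift !mxE.
have mcA : measurable (cons_cV (n:=n) @^-1` A).
  by rewrite -[X in measurable X]setTI; exact: measurable_cons_cV.
transitivity (pushforward (lebesgue_measure \x lebesgue_cV R n)%E f
  (cons_cV (n:=n) @^-1` A)) => //.
apply/esym/product_measure_unique => //.
move=> B C mB mC; rewrite /pushforward.
transitivity ((lebesgue_measure \x lebesgue_cV R n)%E
  ((f1 @^-1` B) `*` (f2 @^-1` C))); first by [].
rewrite product_measure1E.
- by congr (_ * _)%E; [exact: lebesgue_measure_reflect|exact: ih].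
- by rewrite -[X in measurable X]setTI; exact: mf1.
- by rewrite -[X in measurable X]setTI; exact: mf2.
Qed.

Lemma ge0_integral_lebesgue_cVS n (f : 'cV[R]_n.+1 -> \bar R) :
  measurable_fun setT f -> (forall x, (0 <= f x)%E) ->
  (\int[lebesgue_cV R n.+1]_x f x =
   \int[lebesgue_measure]_t \int[lebesgue_cV R n]_x f (cons_cV (t, x)))%E.
Proof.
move=> mf f0; rewrite [LHS](ge0_integral_pushforward (@measurable_cons_cV R n))//.
rewrite preimage_setT fubini_tonelli1//.
  by apply: measurableT_comp => //; exact: measurable_cons_cV.
by move=> x /=.
Qed.

(** Tonelli, one coordinate at a time: the integral of the product is the product of finite
    one-dimensional integrals. Such products serve below to dominate Gaussian kernels. *)
Lemma integrable_prod_cV n (g : 'I_n -> R -> R) :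
  (forall i x, 0 <= g i x) ->
  (forall i, lebesgue_measure.-integrable setT (EFin \o g i)) ->
  (lebesgue_cV R n).-integrable setT
    (fun x : 'cV[R]_n => (\prod_i g i (x i ord0))%:E).
Proof.
move=> g0 ig.
have mg i : measurable_fun setT (g i) by have /integrableP[/measurable_EFinP] := ig i.
have mprod m (h : 'I_m -> R -> R) : (forall i, measurable_fun setT (h i)) ->
    measurable_fun [set: 'cV[R]_m] (fun x => (\prod_i h i (x i ord0))%:E).
  move=> mh; apply/measurable_EFinP; apply: measurable_prod => i _.
  by apply: measurableT_comp; [exact: mh|exact: measurable_coord].
apply/integrableP; split; first exact: mprod.
under eq_integral do rewrite gee0_abs ?lee_fin ?prodr_ge0//.
elim: n g g0 ig mg => [|n ih] g g0 ig mg.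
  (* In dimension 0 the measure is a Dirac mass and the empty product is 1. *)
  rewrite integral_dirac//; last exact: mprod.
  by rewrite big_ord0 mule1 diracE ltry.
rewrite ge0_integral_lebesgue_cVS//; last 2 first.
- exact: mprod.
- by move=> x; rewrite lee_fin prodr_ge0.
have int_fin : (\int[lebesgue_cV R n]_x
    (\prod_(i < n) g (lift ord0 i) (x i ord0))%:E < +oo)%E.
  by exact: (ih (fun i => g (lift ord0 i))).
set I := (X in (X < +oo)%E) in int_fin.
have I0 : (0 <= I)%E by apply: integral_ge0 => x _; rewrite lee_fin prodr_ge0.
(* For a fixed first coordinate, its factor leaves the inner integral, and the constant [I]
   remains. *)
rewrite (@eq_integral _ (measurableTypeR R) R lebesgue_measure setT
    (fun t => (g ord0 t)%:E * I)%E); last first.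
  move=> t _; rewrite -ge0_integralZl//; last 3 first.
  - exact: (mprod _ (fun i => g (lift ord0 i))).
  - by move=> x _; rewrite lee_fin prodr_ge0.
  - by rewrite lee_fin.
  apply: eq_integral => x _; rewrite big_ord_recl cons_cV0 EFinM.
  by under eq_bigr do rewrite cons_cV_lift.
have mg0 : measurable_fun setT (EFin \o g ord0) by exact/measurable_EFinP.
rewrite ge0_integralZr//; last by move=> x _; rewrite lee_fin.
rewrite lte_mul_pinfty//.
- by apply: integral_ge0 => x _; rewrite lee_fin.
- by apply: integrable_fin_num => //; exact: ig.
Qed.

End lebesgue_cV.

(** If the integral vanished, f would be zero almost everywhere on D, and D would be negligible. *)
Lemma integral_gt0 d (T : measurableType d) (R : realType)
    (mu : {measure set T -> \bar R}) (D : set T) (f : T -> R) :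
  measurable D -> measurable_fun D f -> (forall x, D x -> 0 < f x) ->
  (0 < mu D)%E -> (0 < \int[mu]_(x in D) (f x)%:E)%E.
Proof.
move=> mD mf f0 muD; have f0' x : D x -> (0 <= (f x)%:E)%E.
  by move=> Dx; rewrite lee_fin ltW// f0.
rewrite lt_def integral_ge0// andbT; apply/negP => /eqP fi0.
have : (\int[mu]_(x in D) `|(f x)%:E|)%E = 0%E.
  rewrite -[RHS]fi0; apply: eq_integral => x /[!inE] Dx.
  by rewrite gee0_abs// f0'.
move=> /(ae_eq_integral_abs mu mD (proj2 (measurable_EFinP _ _) mf)) ae0.
have /(measure_negligible mD) D0 : mu.-negligible D.
  apply: negligibleS ae0 => x Dx /(_ Dx) [] fx0.
  by have := f0 _ Dx; rewrite fx0 ltxx.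
by rewrite D0 ltxx in muD.
Qed.

Section lebesgue_cV_theory.
Context {R : realType}.

(** D contains an open cube of side 2 r, whose measure is a product of positive lengths. *)
Lemma lebesgue_cV_cube_gt0 n (D : set 'cV[R]_n) (c : 'cV[R]_n) (r : R) :
  measurable D -> 0 < r ->
  (forall x : 'cV[R]_n, (forall i, `|x i ord0 - c i ord0| < r) -> D x) ->
  (0 < lebesgue_cV R n D)%E.
Proof.
move=> mD r0 cD.
pose A i : set (measurableTypeR R) := `]c i ord0 - r, c i ord0 + r[%classic.
have mA i : measurable (A i) by exact: measurable_itv.
have mbox : measurable [set x : 'cV[R]_n | forall i, A i (x i ord0)].
  rewrite (_ : [set x | _] = \bigcap_(i in [set: 'I_n])
      ((fun x : 'cV[R]_n => x i ord0) @^-1` A i)).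
    apply: fin_bigcap_measurable => [|i _]; first exact: finite_finset.
    by have := @measurable_coord R n i measurableT _ (mA i); rewrite setTI.
  by apply/seteqP; split=> [x h i _|x h i]; [exact: h|exact: (h i Logic.I)].
apply: (@lt_le_trans _ _ (lebesgue_cV R n [set x | forall i, A i (x i ord0)])).
  rewrite lebesgue_cV_box//.
  apply: (big_ind (fun x => 0 < x)%E) => //.
    by move=> x y; exact: mule_gt0.
  move=> i _; rewrite /A lebesgue_measure_itv/= lte_fin.
  rewrite ifT; last by lra.
  by rewrite -EFinB lte_fin; lra.
apply: le_measure; rewrite ?inE// => x /= h; apply: cD => i.
have := h i; rewrite /A /= in_itv/= => /andP[? ?].
by rewrite ltr_norml; apply/andP; split; lra.
Qed.

(** Reflection invariance makes the integral equal to its own negative. This yields the mean of a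
    Gaussian kernel without any explicit integration. *)
Lemma Rintegral_reflect_odd n (c : 'cV[R]_n) (f : 'cV[R]_n -> R) :
  (lebesgue_cV R n).-integrable setT (EFin \o f) ->
  (forall x, f (c - x) = - f x) ->
  \int[lebesgue_cV R n]_x f x = 0.
Proof.
move=> fi fodd.
pose phi (x : 'cV[R]_n) : 'cV[R]_n := c - x.
have mphi : measurable_fun setT phi by exact: measurable_reflect_cV.
have mf : measurable_fun setT (EFin \o f) by have /integrableP[] := fi.
have fiN : (lebesgue_cV R n).-integrable setT ((EFin \o f) \o phi).
  rewrite (_ : _ \o _ = -%E \o (EFin \o f)); first exact: integrableN.
  by apply/funext => x /=; rewrite /phi fodd.
have intN : (\int[lebesgue_cV R n]_x (f x)%:E =
    \int[lebesgue_cV R n]_x (- f x)%:E)%E.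
  transitivity (\int[pushforward (lebesgue_cV R n) phi]_x (f x)%:E)%E.
    apply: eq_measure_integral => A mA _.
    by apply/esym; exact: lebesgue_cV_reflect.
  rewrite (integral_pushforward mphi mf)// preimage_setT.
  by apply: eq_integral => x _ /=; rewrite /phi fodd.
have : \int[lebesgue_cV R n]_x f x = - \int[lebesgue_cV R n]_x f x.
  rewrite -mulN1r -RintegralZl// /Rintegral intN; congr fine.
  by apply: eq_integral => x _; rewrite mulN1r.
lra.
Qed.

End lebesgue_cV_theory.

(** * Unnormalised Gaussian kernels, parametrised by the precision matrix: integrability and mean *)

Definition gauss_kernel (R : realType) d (S : 'M[R]_d) (m x : 'cV[R]_d) : R :=
  expR (- (bform S (x - m) (x - m) / 2)).

Section gauss_kernel.
Context {R : realType} {d : nat}.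
Implicit Types (S : 'M[R]_d) (m : 'cV[R]_d).

Lemma measurable_gauss_kernel S m : measurable_fun setT (gauss_kernel S m).
Proof.
apply: measurableT_comp; first exact: measurable_expR.
apply: measurableT_comp => //; apply: measurable_funM => //.
have mc i : measurable_fun setT (fun x : 'cV[R]_d => (x - m) i ord0).
  under eq_fun do rewrite mxE.
  by apply: measurable_funD; [exact: measurable_coord|exact: measurable_cst].
under eq_fun do rewrite bformE.
apply: measurable_sum => i; apply: measurable_funM; first exact: mc.
under eq_fun do rewrite mxE.
by apply: measurable_sum => j; apply: measurable_funM => //; exact: mc.
Qed.

Lemma gauss_kernel_gt0 S m x : 0 < gauss_kernel S m x.
Proof. exact: expR_gt0. Qed.

Lemma gauss_kernel_ge0 S m x : 0 <= gauss_kernel S m x.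
Proof. exact: expR_ge0. Qed.

Lemma gauss_kernel_reflect S m x :
  gauss_kernel S m (m *+ 2 - x) = gauss_kernel S m x.
Proof.
rewrite /gauss_kernel (_ : m *+ 2 - x - m = - (x - m)).
  by rewrite bformNl bformNr opprK.
by rewrite mulr2n opprB addrAC addrK.
Qed.

Lemma integrable_expR_sqr (a c : R) : 0 < a ->
  lebesgue_measure.-integrable setT (fun t => (expR (- (a * (t - c) ^+ 2)))%:E).
Proof.
(* The function is a multiple of the normal density with mean c and variance s^2 = 1 / (2 a). *)
move=> a0; pose s := Num.sqrt (2 * a)^-1.
have s0 : s != 0 by rewrite gt_eqF// sqrtr_gt0 invr_gt0 mulr_gt0.
have := integrableZl measurableT (normal_peak s)^-1 (integrable_normal_pdf c s).
apply: eq_integrable => // t _ /=.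
rewrite normal_pdfE// -EFinM mulKf ?gt_eqF ?normal_peak_gt0//.
congr (expR _)%:E; rewrite sqr_sqrtr ?invr_ge0 ?mulr_ge0 ?ltW// -mulr_natr.
by field; rewrite gt_eqF.
Qed.

(** Chains |t| <= 1 + t^2 <= (1 + 1/a) (1 + a t^2) with 1 + u <= exp u. *)
Lemma le_norm_expR_sqr (a t : R) : 0 < a ->
  `|t| <= (1 + a^-1) * expR (a * t ^+ 2).
Proof.
move=> a0; apply: (@le_trans _ _ (1 + t ^+ 2)).
  rewrite -real_normK ?num_real//; set u := `|t|.
  have : 0 <= (u - 1) ^+ 2 by exact: sqr_ge0.
  have : 0 <= u by exact: normr_ge0.
  nra.
apply: (@le_trans _ _ ((1 + a^-1) * (1 + a * t ^+ 2))).
  have ai : 0 < a^-1 by rewrite invr_gt0.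
  rewrite mulrDl mul1r mulrDr mulr1 mulKf ?gt_eqF//.
  have := sqr_ge0 t; nra.
by rewrite ler_pM2l ?expR_ge1Dx// addr_gt0 ?invr_gt0.
Qed.

(** Coercivity with constant b bounds the kernel by exp (- b q / 2), where q is the squared distance
    to m. With a = b / 4 this is the square of exp (- a q): one factor is kept as the product bound,
    the other absorbs the linear term. *)
Lemma gauss_kernel_bound S m : posdefmx S ->
  exists2 a, 0 < a & exists C, forall x,
    gauss_kernel S m x <= C * \prod_i expR (- (a * (x i ord0 - m i ord0) ^+ 2)) /\
    forall i, `|x i ord0 - m i ord0| * gauss_kernel S m x <=
      C * \prod_i expR (- (a * (x i ord0 - m i ord0) ^+ 2)).
Proof.
move=> /posdefmx_coercive[b b0 bS]; pose a := b / 4.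
have a0 : 0 < a by rewrite divr_gt0.
exists a => //; exists (1 + a^-1) => x.
rewrite -expR_sum sumrN -mulr_sumr.
set q := \sum_i _; have q0 : 0 <= q by apply: sumr_ge0 => i _; exact: sqr_ge0.
have C1 : 1 <= 1 + a^-1 by rewrite lerDl invr_ge0 ltW.
have kq : gauss_kernel S m x <= expR (- (a * q)) * expR (- (a * q)).
  rewrite -expRD ler_expR; have := bS (x - m).
  under eq_bigr do rewrite !mxE.
  by rewrite -/q /a; lra.
have e1 : expR (- (a * q)) <= 1.
  by rewrite -expR0 ler_expR oppr_le0 mulr_ge0 // ltW.
have e0 := expR_gt0 (- (a * q)).
split; first by apply: le_trans kq _; nra.
move=> i; have tq : `|x i ord0 - m i ord0| <= (1 + a^-1) * expR (a * q).
  apply: le_trans (le_norm_expR_sqr _ a0) _.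
  rewrite ler_pM2l ?(lt_le_trans ltr01)// ler_expR ler_pM2l//.
  rewrite /q (bigD1 i)//= lerDl; apply: sumr_ge0 => j _; exact: sqr_ge0.
apply: (@le_trans _ _ ((1 + a^-1) * expR (a * q) *
  (expR (- (a * q)) * expR (- (a * q))))).
  by apply: ler_pM => //; exact: gauss_kernel_ge0.
by rewrite -mulrA (mulrA (expR _)) -expRD subrr expR0 mul1r.
Qed.

Lemma integrable_gauss_kernel S m : posdefmx S ->
  (lebesgue_cV R d).-integrable setT (EFin \o gauss_kernel S m).
Proof.
move=> /(gauss_kernel_bound m)[a a0 [C kC]].
have := integrableZl measurableT C (integrable_prod_cV
  (g := fun i t => expR (- (a * (t - m i ord0) ^+ 2)))
  (fun i t => expR_ge0 _) (fun i => integrable_expR_sqr (m i ord0) a0)).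
apply: le_integrable => //.
  by apply/measurable_EFinP; exact: measurable_gauss_kernel.
move=> x _ /=; rewrite lee_fin ger0_norm ?gauss_kernel_ge0//.
by rewrite (le_trans _ (ler_norm _))//; have [] := kC x.
Qed.

Lemma integrable_coord_gauss_kernel S m i : posdefmx S ->
  (lebesgue_cV R d).-integrable setT
    (EFin \o (fun x : 'cV[R]_d => (x i ord0 - m i ord0) * gauss_kernel S m x)).
Proof.
move=> /(gauss_kernel_bound m)[a a0 [C kC]].
have := integrableZl measurableT C (integrable_prod_cV
  (g := fun i t => expR (- (a * (t - m i ord0) ^+ 2)))
  (fun i t => expR_ge0 _) (fun i => integrable_expR_sqr (m i ord0) a0)).
apply: le_integrable => //.
  apply/measurable_EFinP; apply: measurable_funM.
    by apply: measurable_funB => //; exact: measurable_coord.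
  exact: measurable_gauss_kernel.
move=> x _ /=; rewrite lee_fin normrM [X in _ * X]ger0_norm.
  by rewrite (le_trans _ (ler_norm _))//; have [_] := kC x.
exact: gauss_kernel_ge0.
Qed.

Lemma Rintegral_gauss_kernel_gt0 S m : posdefmx S ->
  0 < \int[lebesgue_cV R d]_x gauss_kernel S m x.
Proof.
move=> Sp; rewrite /Rintegral fine_gt0//; apply/andP; split.
  apply: integral_gt0 => //; first exact: measurable_gauss_kernel.
  by move=> x _; exact: gauss_kernel_gt0.
  by apply: (lebesgue_cV_cube_gt0 (c := 0) (r := 1)).
rewrite ltey_eq; apply/orP; left.
by apply: integrable_fin_num => //; exact: integrable_gauss_kernel.
Qed.

(** Split the coordinate as (x_i - m_i) + m_i: the first part times the kernel is odd under
    reflection in m and integrates to 0. *)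
Lemma Rintegral_coord_gauss_kernel S m i : posdefmx S ->
  \int[lebesgue_cV R d]_x (x i ord0 * gauss_kernel S m x) =
  m i ord0 * \int[lebesgue_cV R d]_x gauss_kernel S m x.
Proof.
move=> Sp; have ik := integrable_gauss_kernel m Sp.
have ick := integrable_coord_gauss_kernel m i Sp.
have h0 : \int[lebesgue_cV R d]_x ((x i ord0 - m i ord0) * gauss_kernel S m x) = 0.
  apply: (Rintegral_reflect_odd (c := m *+ 2)) => // x.
  rewrite gauss_kernel_reflect -mulNr; congr (_ * _).
  by rewrite !mxE; ring.
rewrite -[RHS]add0r -[X in X + _]h0 -RintegralZl// -RintegralD//.
  by apply: eq_Rintegral => x _; ring.
exact: (integrableZl measurableT (m i ord0) ik).
Qed.

End gauss_kernel.

(** The factor k is chosen before [mu], so in the likelihood it does not vary with the parameter and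
    cancels in the posterior. Its positivity rests on that of the determinant. *)
Lemma gauss_pdf_kernelE (R : realType) d (S : 'M[R]_d) : posdefmx S ->
  exists2 k, 0 < k & forall mu x, gauss_pdf mu S x = k * gauss_kernel (invmx S) mu x.
Proof.
move=> Sp; exists (Num.sqrt ((2 * pi) ^+ d * \det S))^-1 => //.
by rewrite invr_gt0 sqrtr_gt0 mulr_gt0 ?posdefmx_det_gt0// exprn_gt0// mulr_gt0 ?pi_gt0.
Qed.

(** * The posterior mean and the sign criterion for the DPP *)

Section posterior.
Context {R : realType} {d n : nat}.
Implicit Types (P L S : 'M[R]_d) (mu m lambda : 'cV[R]_d) (y : 'I_n -> 'cV[R]_d).

Lemma bform_sumr S (u : 'cV[R]_d) y : \sum_i bform S u (y i) = bform S u (\sum_i y i).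
Proof. by rewrite /bform mulmx_sumr summxE. Qed.

(** The equation for m says that the quadratic function of theta on the left is stationary at m.
    Hence the terms linear in theta - m cancel, leaving the pure square and the value at m. *)
Lemma complete_square P L mu m y theta : P^T = P -> L^T = L ->
  (P + n%:R *: L) *m m = P *m mu + L *m \sum_i y i ->
  bform P (theta - mu) (theta - mu) +
    \sum_i bform L (y i - theta) (y i - theta) =
  bform (P + n%:R *: L) (theta - m) (theta - m) +
    (bform P (m - mu) (m - mu) + \sum_i bform L (y i - m) (y i - m)).
Proof.
move=> PT LT mE; set h := theta - m; set u := m - mu.
have -> : theta - mu = h + u by rewrite /h /u addrA subrK.
pose w i := y i - m.
(* The equation for m rearranges to P (m - mu) = L (sum of the y_i - m); pair both sides with h. *)
have cross : bform P h u = \sum_i bform L h (w i).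
  rewrite bform_sumr /bform -!mulmxA; congr ((_ *m _) _ _).
  rewrite sumrB sumr_const card_ord !mulmxBr; apply/eqP.
  rewrite subr_eq addrAC -subr_eq opprK addrC.
  by rewrite -scaler_nat -scalemxAr scalemxAl -mulmxDl mE addrC.
have LE i : bform L (y i - theta) (y i - theta) =
    bform L (w i) (w i) - bform L h (w i) *+ 2 + bform L h h.
  rewrite (_ : y i - theta = w i - h); last by rewrite opprB addrA subrK.
  rewrite (bformDl _ (w i)) !(bformDr _ (w i)) !(bformNl, bformNr) opprK.
  by rewrite (bformC (w i) h LT); ring.
under eq_bigr do rewrite LE.
rewrite !big_split/= sumrN sumrMnl -cross sumr_const card_ord -mulr_natl.
rewrite bform_addmx bform_scalemx (bformDl _ h u) !(bformDr _ h u) (bformC u h PT).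
by rewrite /w; ring.
Qed.

Lemma sum_sample_mean y : (0 < n)%N -> \sum_i y i = n%:R *: sample_mean y.
Proof. by move=> n0; rewrite scalerA divff ?scale1r// pnatr_eq0 -lt0n. Qed.

Variables (mupi : 'cV[R]_d) (Sigmapi Lambda : 'M[R]_d).
Hypotheses (Sigmapi_pd : posdefmx Sigmapi) (Lambda_pd : posdefmx Lambda).
Hypothesis n_gt0 : (0 < n)%N.

Let Q := invmx Sigmapi + n%:R *: invmx Lambda.

Lemma posterior_precision_posdef : posdefmx Q.
Proof.
apply: posdefmxD; first exact: posdefmx_inv.
by apply: posdefmxZ; [rewrite ltr0n|exact: posdefmx_inv].
Qed.

Lemma posterior_meanE y : posterior_mean mupi Sigmapi Lambda y =
  posterior_cov n Sigmapi Lambda *m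
    (invmx Sigmapi *m mupi + n%:R *: (invmx Lambda *m sample_mean y)).
Proof.
set m := RHS; have Qp := posterior_precision_posdef.
have [PT _] := posdefmx_inv Sigmapi_pd; have [LT _] := posdefmx_inv Lambda_pd.
have mE : Q *m m = invmx Sigmapi *m mupi + invmx Lambda *m \sum_i y i.
  rewrite /m /posterior_cov mulKVmx ?posdefmx_unit// sum_sample_mean//.
  by rewrite scalemxAr.
have [k1 k10 priorE] := gauss_pdf_kernelE Sigmapi_pd.
have [k2 k20 likE] := gauss_pdf_kernelE Lambda_pd.
have [C C0 CE] : exists2 C, 0 < C & forall theta,
    gauss_pdf mupi Sigmapi theta * likelihood Lambda y theta =
    C * gauss_kernel Q m theta.
  (* The normalising factors of the prior and of the n observations, times the exponential of the
     remainder from completing the square; theta does not occur. *)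
  exists (k1 * k2 ^+ n * expR (- ((bform (invmx Sigmapi) (m - mupi) (m - mupi) +
      \sum_i bform (invmx Lambda) (y i - m) (y i - m)) / 2))).
    by rewrite !mulr_gt0 ?exprn_gt0 ?expR_gt0.
  move=> theta; rewrite priorE /likelihood.
  under eq_bigr do rewrite likE.
  rewrite big_split/= prodr_const card_ord -expR_sum sumrN -mulr_suml.
  rewrite /gauss_kernel mulrACA -expRD -[RHS]mulrA -expRD.
  congr (_ * expR _); rewrite -!opprD -!mulrDl; congr (- (_ / _)).
  by rewrite (complete_square _ PT LT mE) addrC.
have Z0 := Rintegral_gauss_kernel_gt0 m Qp.
have ik := integrable_gauss_kernel m Qp.
set Z := \int[_]_x _ in Z0.
(* [C] cancels between the numerator and the evidence integral. *)
have postE : posterior_pdf (gauss_pdf mupi Sigmapi) (likelihood Lambda y) =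
    fun theta => Z^-1 * gauss_kernel Q m theta.
  apply/funext => theta; rewrite /posterior_pdf CE.
  under eq_Rintegral do rewrite CE.
  by rewrite RintegralZl// -/Z; field; rewrite !gt_eqF.
apply/matrixP => i j; rewrite (ord1 j) /posterior_mean postE mxE.
under eq_Rintegral do rewrite mulrCA.
rewrite RintegralZl//.
  by rewrite Rintegral_coord_gauss_kernel// -/Z mulrC mulfK// gt_eqF.
have := integrableD measurableT (integrable_coord_gauss_kernel m i Qp)
  (integrableZl measurableT (m i ord0) ik).
by apply: eq_integrable => // x _ /=; rewrite -EFinM -EFinD; congr EFin; ring.
Qed.

(** Writing [mupi] and the sample mean as [Sp *m (Q *m v)] and subtracting each from the posterior
    mean, one of the two precision terms cancels each time. The differences in the DPP become n (a
    z) and - (b z). *)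
Lemma DPP_sign lambda y :
  let a := lambda^T *m posterior_cov n Sigmapi Lambda *m invmx Lambda in
  let b := lambda^T *m posterior_cov n Sigmapi Lambda *m invmx Sigmapi in
  let z := sample_mean y - mupi in
  DPP mupi Sigmapi Lambda lambda y <->
  (a *m z) ord0 ord0 * (b *m z) ord0 ord0 < 0.
Proof.
move=> a b z; rewrite /DPP posterior_meanE.
have Qu := posdefmx_unit posterior_precision_posdef.
set Sp := posterior_cov n Sigmapi Lambda; set ybar := sample_mean y in z *.
set m := Sp *m _.
have cov_mean v : Sp *m (Q *m v) = v by rewrite /Sp /posterior_cov mulKmx.
have -> : linear_feature lambda m - linear_feature lambda mupi =
    n%:R * (a *m z) ord0 ord0.
  have <- : (lambda^T *m (m - mupi)) ord0 ord0 =
      linear_feature lambda m - linear_feature lambda mupi.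
    by rewrite mulmxBr mxE [X in _ + X]mxE.
  rewrite -{1}(cov_mean _ mupi) /m -mulmxBr mulmxDl opprD addrACA subrr add0r.
  rewrite -scalemxAl -scalerBr -mulmxBr -scalemxAr -scalemxAr mxE.
  by rewrite /a !mulmxA.
have -> : linear_feature lambda m - linear_feature lambda ybar =
    - (b *m z) ord0 ord0.
  have <- : (lambda^T *m (m - ybar)) ord0 ord0 =
      linear_feature lambda m - linear_feature lambda ybar.
    by rewrite mulmxBr mxE [X in _ + X]mxE.
  rewrite -{1}(cov_mean _ ybar) /m -mulmxBr mulmxDl opprD -scalemxAl addrACA.
  rewrite subrr addr0 -mulmxBr -(opprB ybar) !mulmxN mxE /b !mulmxA//.
rewrite mulrN oppr_gt0 -mulrA pmulr_rlt0// ltr0n//.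
Qed.

End posterior.

(** * Pairs of linear forms and the wedge on which they have opposite signs *)

Section linear_forms.
Context {R : realType} {d : nat}.
Implicit Types (a b : 'rV[R]_d) (z x c : 'cV[R]_d).

Lemma measurable_linear_form a (mu : 'cV[R]_d) :
  measurable_fun setT (fun x : 'cV[R]_d => (a *m (x - mu)) ord0 ord0).
Proof.
under eq_fun do rewrite mxE.
apply: measurable_sum => i; apply: measurable_funM => //.
under eq_fun do rewrite !mxE.
by apply: measurable_funB => //; exact: measurable_coord.
Qed.

Lemma linear_form_cube a z c (r : R) :
  (forall i, `|z i ord0 - c i ord0| < r) ->
  `|(a *m z) ord0 ord0 - (a *m c) ord0 ord0| <= (\sum_i `|a ord0 i|) * r.
Proof.
move=> zc; rewrite !mxE -sumrB mulr_suml; apply: le_trans (ler_norm_sum _ _ _) _.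
apply: ler_sum => i _; rewrite -mulrBr normrM ler_wpM2l//.
exact/ltW/zc.
Qed.

(* The vector [|b| a - |a| b] works, by the equality case of Cauchy-Schwarz. *)
Lemma exists_separating_vector a b : a != 0 -> b != 0 ->
  ~ (exists c : R, 0 < c /\ a = c *: b) ->
  exists z, 0 < (a *m z) ord0 ord0 /\ (b *m z) ord0 ord0 < 0.
Proof.
move=> a0 b0 ab; have [_ posd] := @posdefmx1 R d.
pose dot := bform (1%:M : 'M[R]_d); pose u := a^T; pose v := b^T.
have dotE (w : 'rV[R]_d) z : (w *m z) ord0 ord0 = dot w^T z.
  by rewrite /dot /bform trmxK mulmx1.
have u0 : 0 < dot u u by apply: posd; rewrite trmx_eq0.
have v0 : 0 < dot v v by apply: posd; rewrite trmx_eq0.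
pose p := Num.sqrt (dot u u); pose q := Num.sqrt (dot v v).
have p0 : 0 < p by rewrite sqrtr_gt0.
have q0 : 0 < q by rewrite sqrtr_gt0.
have pE : dot u u = p ^+ 2 by rewrite sqr_sqrtr// ltW.
have qE : dot v v = q ^+ 2 by rewrite sqr_sqrtr// ltW.
have vu : dot v u = dot u v by rewrite /dot bformC// trmx1.
pose z := q *: u - p *: v; exists z.
have z0 : z != 0.
  apply/eqP => /eqP; rewrite subr_eq0 => /eqP quv; apply: ab.
  exists (p / q); split; first exact: divr_gt0.
  apply: trmx_inj; rewrite linearZ/= -/u -/v mulrC -scalerA -quv scalerA.
  by rewrite mulVf ?scale1r// gt_eqF.
have dotz w : dot w z = q * dot w u - p * dot w v.
  by rewrite /dot /z bformDr bformNr !bformZr.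
have uz : dot u z = p * (p * q - dot u v) by rewrite dotz pE; ring.
have vz : dot v z = - (q * (p * q - dot u v)) by rewrite dotz vu qE; ring.
have : 0 < dot z z by exact: posd.
rewrite [X in 0 < X](_ : _ = q * dot u z - p * dot v z); last first.
  by rewrite /dot {1}/z bformDl bformNl !bformZl.
rewrite uz vz mulrN opprK.
rewrite [X in 0 < X](_ : _ = (p * q *+ 2) * (p * q - dot u v)); last by ring.
rewrite pmulr_rgt0 ?mulrn_wgt0 ?mulr_gt0// => pq.
by rewrite !dotE uz vz oppr_lt0 !mulr_gt0.
Qed.

Definition wedge a b (mu : 'cV[R]_d) : set 'cV[R]_d :=
  [set x | 0 < (a *m (x - mu)) ord0 ord0 /\ (b *m (x - mu)) ord0 ord0 < 0].

Lemma measurable_wedge a b (mu : 'cV[R]_d) : measurable (wedge a b mu).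
Proof.
rewrite (_ : wedge a b mu =
    (fun x : 'cV[R]_d => (a *m (x - mu)) ord0 ord0) @^-1` `]0, +oo[%classic `&`
    (fun x : 'cV[R]_d => (b *m (x - mu)) ord0 ord0) @^-1` `]-oo, 0[%classic).
  apply: measurableI; rewrite -[X in measurable X]setTI.
    exact: (measurable_linear_form a mu).
  exact: (measurable_linear_form b mu).
by apply/seteqP; split=> x /=; rewrite !in_itv/= andbT.
Qed.

Lemma lebesgue_cV_wedge_gt0 a b (mu z : 'cV[R]_d) :
  0 < (a *m z) ord0 ord0 -> (b *m z) ord0 ord0 < 0 ->
  (0 < lebesgue_cV R d (wedge a b mu))%E.
Proof.
move=> az bz.
(* With r = e / s, either form varies by less than e on the cube of half-width r around z, while a z
   and - b z are at least e. The summand 1 makes s positive and the variation strictly smaller than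
   e. *)
pose s := 1 + \sum_i `|a ord0 i| + \sum_i `|b ord0 i|.
have sa : 0 <= \sum_i `|a ord0 i| by exact: sumr_ge0.
have sb : 0 <= \sum_i `|b ord0 i| by exact: sumr_ge0.
have s0 : 0 < s by rewrite /s; lra.
pose e := Num.min ((a *m z) ord0 ord0) (- (b *m z) ord0 ord0).
have e0 : 0 < e by rewrite lt_min az oppr_gt0.
have ea : e <= (a *m z) ord0 ord0 by rewrite ge_min lexx.
have eb : e <= - (b *m z) ord0 ord0 by rewrite ge_min lexx orbT.
pose r := e / s; have r0 : 0 < r by rewrite divr_gt0.
have sr : r + (\sum_i `|a ord0 i|) * r + (\sum_i `|b ord0 i|) * r = e.
  by rewrite -{1}[r]mul1r -!mulrDl -/s /r mulrC divfK// gt_eqF.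
have sar : 0 <= (\sum_i `|a ord0 i|) * r by rewrite mulr_ge0// ltW.
have sbr : 0 <= (\sum_i `|b ord0 i|) * r by rewrite mulr_ge0// ltW.
apply: (@lebesgue_cV_cube_gt0 _ _ _ (z + mu) r) => //.
  exact: measurable_wedge.
move=> x xz.
have {}xz i : `|(x - mu) i ord0 - z i ord0| < r.
  by have := xz i; rewrite !mxE opprD addrA addrAC.
have := linear_form_cube a xz; have := linear_form_cube b xz.
by rewrite /wedge /= !ler_norml => /andP[? ?] /andP[? ?]; split; lra.
Qed.

End linear_forms.

(** * The observations under the data generating model *)

Section data.
Context {R : realType} {d n : nat} {disp : measure_display}.
Context {Omega : measurableType disp} {P : probability Omega R}.
Variables (y : 'I_n -> {RV P >-> 'cV[R]_d}) (muo : 'cV[R]_d) (Sigmao : 'M[R]_d).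
Hypothesis Sigmao_pd : posdefmx Sigmao.
Hypothesis y_normal : forall i, gaussian_vector muo Sigmao (y i).
Hypothesis y_indep : mutually_independent y.

Let my i (V : set 'cV[R]_d) : measurable V -> measurable (y i @^-1` V).
Proof. by move=> mV; rewrite -[X in measurable X]setTI; exact: measurable_funP. Qed.

(** The Gaussian density is positive everywhere, so each observation falls in V with positive
    probability; independence turns the joint event into a finite product of such probabilities. *)
Lemma gaussian_sample_gt0 (V : set 'cV[R]_d) : measurable V ->
  (0 < lebesgue_cV R d V)%E ->
  measurable (\bigcap_(i in [set: 'I_n]) (y i @^-1` V)) /\
  (0 < P (\bigcap_(i in [set: 'I_n]) (y i @^-1` V)))%E.
Proof.
move=> mV V0; split.
  by apply: fin_bigcap_measurable => [|i _]; [exact: finite_finset|exact: my].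
rewrite (y_indep (fun=> mV)); apply: (big_ind (fun x => 0 < x)%E) => //.
  by move=> u v; exact: mule_gt0.
move=> i _; have := y_normal i mV; rewrite /distribution /pushforward /= => ->.
have [k k0 pdfE] := gauss_pdf_kernelE Sigmao_pd.
apply: integral_gt0 => //.
  apply: measurable_funTS; rewrite (_ : gauss_pdf _ _ =
      fun x => k * gauss_kernel (invmx Sigmao) muo x).
    by apply: measurable_funM => //; exact: measurable_gauss_kernel.
  by apply/funext => x; exact: pdfE.
by move=> x _; rewrite pdfE mulr_gt0 ?gauss_kernel_gt0.
Qed.

Lemma linear_form_sample_mean (a : 'rV[R]_d) (mu : 'cV[R]_d) (x : 'I_n -> 'cV[R]_d) :
  (0 < n)%N ->
  (a *m (sample_mean x - mu)) ord0 ord0 =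
  n%:R^-1 * \sum_i (a *m (x i - mu)) ord0 ord0.
Proof.
move=> n0; rewrite -summxE -mulmx_sumr sumrB sumr_const card_ord.
rewrite sum_sample_mean// -(scaler_nat n mu) -scalerBr -scalemxAr [in RHS]mxE mulKf//.
by rewrite pnatr_eq0 -lt0n.
Qed.

Lemma measurable_linear_form_sample_mean (a : 'rV[R]_d) (mu : 'cV[R]_d) :
  (0 < n)%N -> measurable_fun setT
    (fun w => (a *m (sample_mean (fun i => y i w) - mu)) ord0 ord0).
Proof.
move=> n0; under eq_fun do rewrite linear_form_sample_mean//.
apply: measurable_funM => //; apply: measurable_sum => i.
exact: (measurableT_comp (measurable_linear_form a mu)).
Qed.

End data.

(** * From the sign criterion to the probability of the DPP *)

Theorem theorem3p4 (R : realType) (d n : nat) (d_gt1 : (1 < d)%N)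
    (n_ge1 : (1 <= n)%N)
    (Lambda : 'M[R]_d) (Lambda_pd : posdefmx Lambda)
    (mupi : 'cV[R]_d) (Sigmapi : 'M[R]_d) (Sigmapi_pd : posdefmx Sigmapi)
    (muo : 'cV[R]_d) (Sigmao : 'M[R]_d) (Sigmao_pd : posdefmx Sigmao)
    (disp : measure_display) (Omega : measurableType disp)
    (P : probability Omega R)
    (y : 'I_n -> {RV P >-> 'cV[R]_d})
    (y_normal : forall i, gaussian_vector muo Sigmao (y i))
    (y_indep : mutually_independent y)
    (lambda : 'cV[R]_d) :
  (0 < P [set w | DPP mupi Sigmapi Lambda lambda (fun i => y i w)])%E <->
  ~ (exists c : R, 0 < c /\
       lambda^T *m posterior_cov n Sigmapi Lambda
         *m (invmx Lambda - c *: invmx Sigmapi) = 0).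
Proof.
pose a := lambda^T *m posterior_cov n Sigmapi Lambda *m invmx Lambda.
pose b := lambda^T *m posterior_cov n Sigmapi Lambda *m invmx Sigmapi.
have abE c : lambda^T *m posterior_cov n Sigmapi Lambda
    *m (invmx Lambda - c *: invmx Sigmapi) = a - c *: b.
  by rewrite mulmxBr -scalemxAr.
pose az w := (a *m (sample_mean (fun i => y i w) - mupi)) ord0 ord0.
pose bz w := (b *m (sample_mean (fun i => y i w) - mupi)) ord0 ord0.
rewrite (_ : [set w | _] = [set w | az w * bz w < 0]); last first.
  by apply/seteqP; split=> w /=;
    rewrite (DPP_sign mupi Sigmapi_pd Lambda_pd n_ge1 lambda).
split.
  move=> P0 [c [c0]]; rewrite abE => /eqP; rewrite subr_eq0 => /eqP ab.
  move: P0; rewrite (_ : [set w | _] = set0) ?measure0 ?ltxx//.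
  (* If a = c b, the product is c (b z)^2, which is never negative: the event is empty. *)
  apply/seteqP; split=> // w /=; rewrite /az ab -scalemxAl mxE -/(bz w) -mulrA.
  by rewrite pmulr_rlt0// ltNge -expr2 sqr_ge0.
move=> nprop; have abN : ~ (exists c : R, 0 < c /\ a = c *: b).
  by move=> [c [c0 ab]]; apply: nprop; exists c; rewrite abE ab subrr.
have Lu : invmx Lambda \in unitmx by rewrite unitmx_inv posdefmx_unit.
have Su : invmx Sigmapi \in unitmx by rewrite unitmx_inv posdefmx_unit.
pose l := lambda^T *m posterior_cov n Sigmapi Lambda.
have l0 : l != 0.
  (* If l = 0 then a = b = 0, so any positive c, here 1, meets the excluded condition; this covers
     lambda = 0. *)
  apply/eqP => l0; apply: abN; exists 1; split; first exact: ltr01.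
  by rewrite scale1r /a /b -/l l0 !mul0mx.
have a0 : a != 0.
  by apply: contra l0 => /eqP al; rewrite -[l](mulmxK Lu) -/a al mul0mx.
have b0 : b != 0.
  by apply: contra l0 => /eqP bl; rewrite -[l](mulmxK Su) -/b bl mul0mx.
have [z [az0 bz0]] := exists_separating_vector a0 b0 abN.
have [mI I0] := gaussian_sample_gt0 Sigmao_pd y_normal y_indep
  (measurable_wedge a b mupi) (lebesgue_cV_wedge_gt0 mupi az0 bz0).
(* Monotonicity asks for measurability of the DPP event, then for the inclusion in it of the event
   that all observations lie in the wedge. *)
apply: (lt_le_trans I0); apply: le_measure; rewrite ?inE//.
  rewrite -[X in measurable X]setTI (_ : [set w | _] =
      (fun w => az w * bz w) @^-1` `]-oo, 0[%classic).
    have mab : measurable_fun setT (fun w => az w * bz w).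
      by apply: measurable_funM; exact: measurable_linear_form_sample_mean.
    exact: mab.
  by apply/seteqP; split=> w /=; rewrite in_itv.
have ni : (0 < n%:R^-1 :> R) by rewrite invr_gt0 ltr0n.
(* Half-spaces are convex, so the sample mean stays in the wedge. *)
move=> w /= yV; rewrite /az /bz !linear_form_sample_mean//.
rewrite pmulr_rlt0; last first.
  rewrite pmulr_rgt0// (bigD1 (Ordinal n_ge1))//= ltr_pwDl//.
    by have [] := yV (Ordinal n_ge1) Logic.I.
  by apply: sumr_ge0 => i _; have [/ltW] := yV i Logic.I.
rewrite pmulr_rlt0// (bigD1 (Ordinal n_ge1))//= -oppr_gt0 opprD -sumrN ltr_pwDl//.
  by rewrite oppr_gt0; have [] := yV (Ordinal n_ge1) Logic.I.
by apply: sumr_ge0 => i _; rewrite oppr_ge0 ltW//; have [] := yV i Logic.I.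
Qed.
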